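(* Let $X$ be a $d$-dimensional tropical cycle in $\mathbb{R}^n$ with a fixed polyhedral structure with $N$ maximal cells, and let $\tau$ be a codimension one cell of $X$. Let $u_1,\dots,u_k\in\mathbb{Z}^n$ be representatives of the primitive normal vectors $u_{\sigma/\tau}$ for all maximal cells $\sigma>\tau$ (so $k$ is the number of maximal cells containing $\tau$). Choose a lattice basis $l_1,\dots,l_{d-1}$ of $\Lambda_\tau$ and define $$M_\tau := \left(u_1\;\dots\;u_k\;l_1\;\dots\;l_{d-1}\right)\in\mathbb{Z}^{n\times(k+d-1)}.$$ Then $$\Lambda_X^\tau\cong\pi\left(\ker(M_\tau)\cap\mathbb{Z}^{k+d-1}\right)\times\mathbb{Z}^{N-k},$$ where $\pi$ is the projection onto the first $k$ coordinates.
   Context: For a polyhedron $\sigma\subset\mathbb{R}^n$, $V_\sigma := \langle a-b : a,b\in\sigma\rangle$ and $\Lambda_\sigma := V_\sigma\cap\mathbb{Z}^n$. If $\tau$ is a codimension one face of the rational polyhedron $\sigma$ and $g$ is an integral linear form whose minimal locus on $\sigma$ is $\tau$, then $u_{\sigma/\tau}$ denotes the unique generator of $\Lambda_\sigma/\Lambda_\tau\cong\mathbb{Z}$ with $g(u_{\sigma/\tau})>0$. A tropical cycle $(X,\omega)$ is a pure rational $d$-dimensional polyhedral complex in $\mathbb{R}^n$ with a weight function $\omega$ from its $d$-dimensional cells to $\mathbb{Z}$ such that for every $(d-1)$-dimensional cell $\tau$, $\sum_{\sigma>\tau}\omega(\sigma)u_{\sigma/\tau}=0$ in $\mathbb{R}^n/V_\tau$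 (balancing condition). For a cell $\tau$ of a polyhedral complex $\mathcal{X}$ with quotient map $\Pi:\mathbb{R}^n\to\mathbb{R}^n/V_\tau$, $\mathrm{Star}_{\mathcal{X}}(\tau) := \{\mathbb{R}_{\ge0}\cdot\Pi(\sigma-\tau) : \tau<\sigma\in\mathcal{X}\}\cup\{0\}$, a fan in $\mathbb{R}^n/V_\tau$ with lattice $\mathbb{Z}^n/\Lambda_\tau$; a weight function on $\mathcal{X}$ induces one on the star by giving $\mathbb{R}_{\ge0}\cdot\Pi(\sigma-\tau)$ the weight of $\sigma$ for $\sigma$ maximal. Let $\sigma_1,\dots,\sigma_N$ be the maximal cells of the polyhedral structure $\mathcal{X}$, and identify $\omega\in\mathbb{Z}^N$ with the weight function $\sigma_i\mapsto\omega_i$. For a codimension one cell $\tau$, $$\Lambda_X^\tau := \{\omega\in\mathbb{Z}^N : \mathrm{Star}_{\mathcal{X}}(\tau)\text{ with the weight function induced by }\omega\text{ is balanced}\}.$$ *)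

(* Defs.v *)
From mathcomp Require Import all_boot all_order all_algebra.
From mathcomp Require Import all_classical reals.

Set Implicit Arguments.
Unset Strict Implicit.
Unset Printing Implicit Defensive.
Import Order.TTheory GRing.Theory Num.Theory.
Local Open Scope classical_set_scope.
Local Open Scope ring_scope.

(* Everything is stated for a finite-dimensional real vector space [V] and a  *)
(* subgroup [L] of [V] playing the role of the lattice, because the same      *)
(* notions are used both for Z^n in R^n and for Z^n / Lambda_tau in           *)
(* R^n / V_tau.                                                               *)

Definition linspan (R : fieldType) (V : vectType R) (A : set V) : {vspace V} :=
  xget 0%VS [set U : {vspace V} | A `<=` [set x | x \in U] /\
    forall W : {vspace V}, A `<=` [set x | x \in W] -> (U <= W)%VS].

(* [quotv U], the quotient V / U, is modelled by the complement of U chosen   *)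
(* by the library; [quot_proj U] is the projection V -> V / U. It is linear,  *)
(* surjective, and its kernel is U: see the lemmas below.                     *)
Definition quotv (R : fieldType) (V : vectType R) (U : {vspace V}) : vectType R :=
  subvs_of (U^C)%VS.

Definition quot_proj (R : fieldType) (V : vectType R) (U : {vspace V}) (v : V) :
  quotv U := vsproj (U^C)%VS (daddv_pi (U^C)%VS U v).

Definition dirspace (R : realType) (V : vectType R) (sigma : set V) : {vspace V} :=
  linspan [set v | exists a b, [/\ sigma a, sigma b & v = a - b]].

Definition pdim (R : realType) (V : vectType R) (sigma : set V) : nat :=
  \dim (dirspace sigma).

Definition cell_lattice (R : realType) (V : vectType R) (L : set V)
  (sigma : set V) : set V := [set v | v \in dirspace sigma] `&` L.

Definition integral_form (R : realType) (V : vectType R) (L : set V)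
  (g : V -> R) : Prop := forall v, L v -> g v \is a Num.int.

(* Rational slopes; the right-hand sides [c i] are arbitrary real numbers.    *)
Definition rational_polyhedron (R : realType) (V : vectType R) (L : set V)
  (sigma : set V) : Prop :=
  exists (m : nat) (g : 'I_m -> {scalar V}) (c : 'I_m -> R),
    (forall i, integral_form L (g i)) /\
    sigma = [set x | forall i, c i <= g i x].

Definition min_locus (R : realType) (V : vectType R) (g : V -> R)
  (sigma : set V) : set V :=
  [set x | sigma x /\ forall y, sigma y -> g x <= g y].

(* Faces are nonempty, and sigma is a face of itself (take g = 0).            *)
Definition face (R : realType) (V : vectType R) (tau sigma : set V) : Prop :=
  tau !=set0 /\ exists g : {scalar V}, tau = min_locus g sigma.

Definition proper_face (R : realType) (V : vectType R) (tau sigma : set V) : Prop :=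
  face tau sigma /\ tau <> sigma.

Definition polyhedral_complex (R : realType) (V : vectType R) (L : set V)
  (X : set (set V)) : Prop :=
  [/\ finite_set X,
      (forall sigma, X sigma -> rational_polyhedron L sigma /\ sigma !=set0),
      (forall sigma tau, X sigma -> face tau sigma -> X tau) &
      (forall sigma sigma', X sigma -> X sigma' ->
         sigma `&` sigma' !=set0 ->
         face (sigma `&` sigma') sigma /\ face (sigma `&` sigma') sigma')].

Definition maximal_cells (R : realType) (V : vectType R) (X : set (set V)) :
  set (set V) :=
  [set sigma | X sigma /\ forall sigma', X sigma' -> ~ proper_face sigma sigma'].

Definition pure_dim (R : realType) (V : vectType R) (d : nat)
  (X : set (set V)) : Prop :=
  forall sigma, maximal_cells X sigma -> pdim sigma = d.

(* [u] is an element of Lambda_sigma whose class in Lambda_sigma / Lambda_tau *)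
(* is the primitive normal vector u_{sigma/tau}.                              *)
Definition normal_rep (R : realType) (V : vectType R) (L : set V)
  (sigma tau : set V) (u : V) : Prop :=
  [/\ cell_lattice L sigma u,
      (forall v, cell_lattice L sigma v ->
         exists z : int, cell_lattice L tau (v - u *~ z)) &
      exists g : {scalar V},
        [/\ integral_form L g, min_locus g sigma = tau & 0 < g u]].

(* The image of u_{sigma/tau} in V / V_tau; it does not depend on the chosen  *)
(* representative.                                                            *)
Definition normal_vector (R : realType) (V : vectType R) (L : set V)
  (sigma tau : set V) : quotv (dirspace tau) :=
  quot_proj (dirspace tau) (xget 0 [set u | normal_rep L sigma tau u]).

(* Balancing condition for a [d]-dimensional complex [X]. Only the values of  *)
(* [w] on [d]-dimensional cells matter.                                       *)
Definition balanced (R : realType) (V : vectType R) (L : set V) (d : nat)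
  (X : set (set V)) (w : set V -> int) : Prop :=
  forall tau, X tau -> (pdim tau).+1 = d ->
    \sum_(sigma \in [set sigma | [/\ X sigma, pdim sigma = d &
                                     proper_face tau sigma]])
       normal_vector L sigma tau *~ w sigma = 0.

Definition tropical_cycle (R : realType) (V : vectType R) (L : set V) (d : nat)
  (X : set (set V)) (w : set V -> int) : Prop :=
  [/\ polyhedral_complex L X, pure_dim d X & balanced L d X w].

Definition star_cone (R : realType) (V : vectType R) (tau sigma : set V) :
  set (quotv (dirspace tau)) :=
  [set y | exists (r : R) (a b : V),
     [/\ 0 <= r, sigma a, tau b & y = r *: quot_proj (dirspace tau) (a - b)]].
Arguments star_cone {R V} tau sigma _.

Definition star (R : realType) (V : vectType R) (X : set (set V)) (tau : set V) :
  set (set (quotv (dirspace tau))) :=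
  [set star_cone tau sigma | sigma in [set sigma | X sigma /\ proper_face tau sigma]]
  `|` [set [set 0]].
Arguments star {R V} X tau _.

Definition quot_lattice (R : realType) (V : vectType R) (L : set V)
  (tau : set V) : set (quotv (dirspace tau)) := quot_proj (dirspace tau) @` L.
Arguments quot_lattice {R V} L tau _.

(* The weight of a cone of the star is the weight of the maximal cell it      *)
(* comes from (which is unique in a polyhedral complex).                      *)
Definition star_weight (R : realType) (V : vectType R) (X : set (set V))
  (tau : set V) (w : set V -> int) (rho : set (quotv (dirspace tau))) : int :=
  w (xget set0 [set sigma | [/\ maximal_cells X sigma, proper_face tau sigma &
                                star_cone tau sigma = rho]]).

Definition star_balanced (R : realType) (V : vectType R) (L : set V) (d : nat)
  (X : set (set V)) (tau : set V) (w : set V -> int) : Prop :=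
  balanced (quot_lattice L tau) (d - pdim tau) (star X tau) (star_weight X w).

(* The weight function s_i |-> omega_i, for [s] injective.                    *)
Definition weight_of (T : choiceType) (N : nat) (s : 'I_N -> T)
  (omega : 'cV[int]_N) (sigma : T) : int := \sum_(i < N | s i == sigma) omega i 0.

(* Lambda_X^tau, where s_1, ..., s_N are the maximal cells of X.              *)
Definition weight_lattice (R : realType) (V : vectType R) (L : set V) (d : nat)
  (X : set (set V)) (N : nat) (s : 'I_N -> set V) (tau : set V) :
  set 'cV[int]_N :=
  [set omega | star_balanced L d X tau (weight_of s omega)].

Definition intvec (R : realType) (n : nat) (v : 'cV[int]_n) : 'cV[R]_n :=
  map_mx intr v.

Definition Zlattice (R : realType) (n : nat) : set 'cV[R]_n :=
  range (@intvec R n).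
Arguments Zlattice R n _ : clear implicits.

(* The columns of [B] form a Z-basis of the lattice [L] of integer vectors.   *)
Definition lattice_basis (R : realType) (n m : nat) (L : set 'cV[R]_n)
  (B : 'M[int]_(n, m)) : Prop :=
  set_bij [set: 'cV[int]_m] L (fun c => intvec R (B *m c)).

Definition subgroup (G : zmodType) (A : set G) : Prop :=
  A 0 /\ forall x y, A x -> A y -> A (x - y).

(* Isomorphism of the subgroups [A] of [G] and [B] of [H]; the values of [f]  *)
(* outside [A] are irrelevant.                                                *)
Definition isomorphic (G H : zmodType) (A : set G) (B : set H) : Prop :=
  [/\ subgroup A, subgroup B &
      exists f : G -> H,
        (forall x y, A x -> A y -> f (x + y) = f x + f y) /\ set_bij A B f].

Definition int_ker (n m : nat) (M : 'M[int]_(n, m)) : set 'cV[int]_m :=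
  [set x | M *m x = 0].

Lemma linspanP (R : fieldType) (V : vectType R) (A : set V) :
  A `<=` [set x | x \in linspan A] /\
  forall W : {vspace V}, A `<=` [set x | x \in W] -> (linspan A <= W)%VS.
Proof.
rewrite /linspan; case: xgetP => [U _ [] //|noU]; exfalso.
pose ok (s : seq V) := [set` s] `<=` A.
have step k : exists2 s, ok s & (k <= \dim <<s>>)%N.
  elim: k => [|k [s sA ks]]; first by exists [::].
  have [sub|/existsNP[x /not_implyP[Ax /negP xs]]] :=
    pselect (A `<=` [set x | x \in <<s>>%VS]).
    case: (noU <<s>>%VS); split => // W AW; apply/span_subvP => x xs.
    exact/AW/sA.
  exists (x :: s).
    by move=> y /=; rewrite inE => /orP[/eqP -> //|]; apply: sA.
  rewrite span_cons (leq_ltn_trans ks)// (ltn_leqif (dimv_leqif_sup _)) ?addvSr//.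
  by apply: contra xs; rewrite subv_add -memvE => /andP[].
have [s _] := step (\dim {: V}).+1.
by rewrite leqNgt ltnS dimvS ?subvf.
Qed.

Lemma quot_proj_linear (R : fieldType) (V : vectType R) (U : {vspace V}) :
  linear (quot_proj U).
Proof. by move=> a u v; rewrite /quot_proj !linearP. Qed.

Lemma quot_proj_surj (R : fieldType) (V : vectType R) (U : {vspace V})
  (y : quotv U) : exists v, quot_proj U v = y.
Proof.
exists (vsval y); rewrite /quot_proj daddv_pi_id ?vsvalK ?subvsP//.
by rewrite capvC capv_compl.
Qed.

Lemma quot_proj_ker (R : fieldType) (V : vectType R) (U : {vspace V}) (v : V) :
  quot_proj U v = 0 <-> v \in U.
Proof.
have CU : ((U^C)%VS :&: U = 0)%VS by rewrite capvC capv_compl.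
have dec : daddv_pi (U^C)%VS U v + daddv_pi U (U^C)%VS v = v.
  by apply: daddv_pi_add => //; rewrite addvC addv_complf memvf.
split=> [/(congr1 vsval)|vU].
  rewrite vsprojK ?memv_pi// linear0 => v0.
  by rewrite -dec v0 add0r memv_pi.
rewrite /quot_proj; have -> : daddv_pi (U^C)%VS U v = 0; last by rewrite linear0.
apply/eqP; rewrite -memv0 -CU memv_cap memv_pi /=.
by rewrite -[X in X \in _](addrK (daddv_pi U (U^C)%VS v)) dec memvB ?memv_pi.
Qed.

(* Main.v *)
From HB Require Import structures.
Require Import Defs.
From mathcomp Require Import all_boot all_order all_algebra.
From mathcomp Require Import all_classical reals.
From mathcomp Require Import lra.
Set Implicit Arguments.
Unset Strict Implicit.
Unset Printing Implicit Defensive.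
Import Order.TTheory GRing.Theory Num.Theory.
Local Open Scope classical_set_scope.
Local Open Scope ring_scope.

(** Because tau has codimension one, its star is a one-dimensional fan: the
    origin together with one ray for each maximal cell containing tau. Hence
    the star satisfies a single balancing condition, the one at the origin.

    Each cell sigma of the complex properly containing tau has larger dimension
    than tau, hence dimension d, and is one of the t_j
    ([maximal_of_proper_face]). Its cone in the star has dimension
    dim sigma - dim tau = 1 ([pdim_star_cone]), the class of u_j is the
    primitive normal vector of that ray over the origin
    ([normal_rep_star_cone], [normal_rep_line_uniq]), and distinct cells give
    distinct rays ([star_cone_sub]), so that the weight of a ray is
    unambiguously the weight of its cell. The condition at the origin therefore
    reads: the sum of the omega(t_j) u_j lies in V_tau ([star_balancedE]).

    This sum is U omega', where omega' collects the coordinates of omega at the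
    t_j. It is an integer vector, so it lies in V_tau if and only if it lies in
    Lambda_tau, that is, equals B c for an integer vector c; equivalently
    (omega', -c) is in the kernel of (U B), and omega' is in its projection
    ([mulmx_in_latticeP]). The N - k other coordinates of omega are
    unconstrained, and splitting off the coordinates at the t_j is the
    isomorphism ([isomorphic_coordinates]). *)

(** * Direction spaces and faces *)

Section Dir.
Variables (R : realType) (V : vectType R).
Implicit Types (A B sigma tau : set V) (g h : {scalar V}).

Lemma dirspace_mem A a b : A a -> A b -> a - b \in dirspace A.
Proof. by move=> Aa Ab; apply: (linspanP _).1; exists a, b. Qed.

Lemma dirspace_min A (W : {vspace V}) :
  (forall a b, A a -> A b -> a - b \in W) -> (dirspace A <= W)%VS.
Proof. by move=> AW; apply: (linspanP _).2 => _ [a [b [Aa Ab ->]]]; apply: AW. Qed.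

Lemma dirspaceS A B : A `<=` B -> (dirspace A <= dirspace B)%VS.
Proof. by move=> AB; apply: dirspace_min => a b /AB Ba /AB; apply: dirspace_mem. Qed.

Lemma dirspace1 (x : V) : dirspace [set x] = 0%VS.
Proof.
apply/eqP; rewrite -subv0; apply: dirspace_min => _ _ -> ->.
by rewrite subrr mem0v.
Qed.

Lemma linear_const_dirspace g A :
  (forall x y, A x -> A y -> g x = g y) -> forall v, v \in dirspace A -> g v = 0.
Proof.
have gl : linear (fun x => g x : R^o) by move=> a u v; rewrite linearP.
pose gL : {linear V -> R^o} := HB.pack (fun x => g x : R^o)
  (GRing.isLinear.Build _ _ _ _ _ gl).
have kerE v : (v \in lker (linfun gL)) = (g v == 0) by rewrite memv_ker lfunE.
move=> gA v; suff sub : (dirspace A <= lker (linfun gL))%VS.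
  by move=> /(subvP sub); rewrite kerE => /eqP.
by apply: dirspace_min => a b Aa Ab; rewrite kerE linearB /= (gA a b)// subrr.
Qed.

Lemma min_locus_sub g sigma : min_locus g sigma `<=` sigma.
Proof. by move=> x []. Qed.

Lemma min_locus_const g sigma x y :
  min_locus g sigma x -> min_locus g sigma y -> g x = g y.
Proof. by move=> [sx mx] [sy my]; apply/eqP; rewrite eq_le mx// my. Qed.

Lemma min_locus_dirspace0 g sigma v :
  v \in dirspace (min_locus g sigma) -> g v = 0.
Proof. by apply: linear_const_dirspace => x y; apply: min_locus_const. Qed.

Lemma min_locus_lt g sigma b x : min_locus g sigma b -> sigma x ->
  ~ min_locus g sigma x -> g b < g x.
Proof.
move=> [sb mb] sx nx; rewrite lt_neqAle mb// andbT; apply/eqP => bx.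
by apply: nx; split=> // y sy; rewrite -bx mb.
Qed.

Lemma proper_min_locus g sigma : min_locus g sigma <> sigma ->
  exists2 x, sigma x & ~ min_locus g sigma x.
Proof.
move=> ne; apply: contrapT => no; apply: ne.
apply/seteqP; split=> [|x sx]; first exact: min_locus_sub.
by apply: contrapT => nx; apply: no; exists x.
Qed.

(** A linear form vanishing on the directions of the smaller set but not on those
    of the larger one witnesses that the inclusion of direction spaces is
    strict. *)
Lemma ltn_pdim g A B b x : A `<=` B -> (forall v, v \in dirspace A -> g v = 0) ->
  B b -> B x -> g b < g x -> (pdim A < pdim B)%N.
Proof.
move=> AB gA Bb Bx gbx; rewrite /pdim (ltn_leqif (dimv_leqif_sup (dirspaceS AB))).
apply/negP => /subvP /(_ _ (dirspace_mem Bx Bb)) /gA.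
by rewrite linearB /= => /eqP; rewrite subr_eq0 gt_eqF.
Qed.

Lemma pdim_proper_face tau sigma : proper_face tau sigma -> (pdim tau < pdim sigma)%N.
Proof.
move=> [[[b tb] [g tauE]] ne]; subst tau.
have [x sx nx] := proper_min_locus ne.
apply: (@ltn_pdim g _ _ b x) => //; first exact: min_locus_sub.
- exact: min_locus_dirspace0.
- exact: min_locus_sub tb.
- exact: (min_locus_lt tb).
Qed.

(** * Stepping from a face into a polyhedron *)

(** Midpoints are the only convex combinations that [strict_point] takes. *)
Definition midpoint_closed A := forall x y, A x -> A y -> A (2^-1 *: (x + y)).

Lemma polyhedron_midpoint (L : set V) sigma :
  rational_polyhedron L sigma -> midpoint_closed sigma.
Proof.
move=> [m [g [c [_ ->]]]] x y gx gy i; have := gx i; have := gy i.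
rewrite linearZ linearD /=; lra.
Qed.

(** Such a p is a relative interior point of tau with respect to the given
    inequalities. It is reached by successive midpoints: averaging with a point
    where a given inequality is strict makes it strict and keeps strict those
    that already are. *)
Lemma strict_point (I : finType) (g : I -> {scalar V}) (c : I -> R) tau :
  tau !=set0 -> midpoint_closed tau -> (forall i x, tau x -> c i <= g i x) ->
  exists2 p, tau p & forall i, (forall x, tau x -> g i x = c i) \/ c i < g i p.
Proof.
move=> [p0 tp0] mid ge.
suff [p tp Hp] : exists2 p, tau p &
    forall i, i \in enum I -> (forall x, tau x -> g i x = c i) \/ c i < g i p.
  by exists p => // i; apply: Hp; rewrite mem_enum.
elim: (enum I) => [|i s [p tp Hp]]; first by exists p0.
have [tight|/existsNP[q /not_implyP[tq /eqP gq]]] :=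
  pselect (forall x, tau x -> g i x = c i).
  by exists p => // j; rewrite inE => /orP[/eqP ->|/Hp//]; left.
have cq : c i < g i q by rewrite lt_neqAle eq_sym gq ge.
exists (2^-1 *: (p + q)); first exact: mid.
move=> j; rewrite inE linearZ linearD /= => /orP[/eqP ->|/Hp[|pj]]; [right|by left|right].
- by have := ge i p tp; lra.
- by have := ge j q tq; lra.
Qed.

(** The inequalities that are not tight on tau are strict at a point of
    [strict_point], hence survive a small enough step in any direction; the tight
    ones only need v to point inwards. *)
Lemma small_step (I : finType) (g : I -> {scalar V}) (c : I -> R) tau v :
  tau !=set0 -> midpoint_closed tau -> (forall i x, tau x -> c i <= g i x) ->
  (forall i, (forall x, tau x -> g i x = c i) -> 0 <= g i v) ->
  exists p e, [/\ tau p, 0 < e & forall i, c i <= g i (p + e *: v)].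
Proof.
move=> ne mid ge tight; have [p tp Hp] := strict_point ne mid ge.
suff [e e0 He] : exists2 e : R, 0 < e &
    forall i, i \in enum I -> c i <= g i (p + e *: v).
  by exists p, e; split=> // i; apply: He; rewrite mem_enum.
elim: (enum I) => [|i s [e e0 He]]; first by exists 1.
have down j d : 0 <= d -> d <= e -> c j <= g j (p + e *: v) -> c j <= g j (p + d *: v).
  move=> d0 de; have := ge j p tp; rewrite !linearD !linearZ /= => cp.
  by have [gv|gv] := leP 0 (g j v); nra.
have [gv|gv] := leP 0 (g i v).
  exists e => // j; rewrite inE => /orP[/eqP ->|/He//].
  by rewrite linearD linearZ /= ler_wpDr ?ge// mulr_ge0// ltW.
have slack : c i < g i p by case: (Hp i) => // /tight; rewrite leNgt gv.
(* the step at which the i-th inequality becomes an equality *)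
pose e' := (g i p - c i) / - g i v.
have e'0 : 0 < e' by rewrite divr_gt0 ?subr_gt0 ?oppr_gt0.
exists (Order.min e e'); first by rewrite lt_min e0 e'0.
move=> j; rewrite inE => /orP[/eqP ->|/He Hj].
  have : Order.min e e' <= e' by rewrite ge_min lexx orbT.
  rewrite /e' ler_pdivlMr ?oppr_gt0// linearD linearZ /=; lra.
by apply: down Hj; rewrite ?le_min ?(ltW e0) ?(ltW e'0)// ge_min lexx.
Qed.

End Dir.

(** * The cones of a star *)

Section Star.
Variables (R : realType) (V : vectType R).
Implicit Types (A B sigma tau : set V) (g h : {scalar V}).

HB.instance Definition _ (U : {vspace V}) :=
  GRing.isLinear.Build R V (quotv U) _ (quot_proj U) (quot_proj_linear U).

(** The bundled linear map gives access to kernels and images of subspaces. *)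
Definition quot_hom (U : {vspace V}) : 'Hom(V, quotv U) := linfun (quot_proj U).

Lemma quot_proj_eq (U : {vspace V}) u v :
  quot_proj U u = quot_proj U v <-> u - v \in U.
Proof.
rewrite -quot_proj_ker linearB /=; split=> [->|/eqP]; first by rewrite subrr.
by rewrite subr_eq0 => /eqP.
Qed.

Lemma quot_proj_val (U : {vspace V}) (y : quotv U) : quot_proj U (vsval y) = y.
Proof.
rewrite /quot_proj daddv_pi_id ?vsvalK ?subvsP//.
by rewrite capvC capv_compl.
Qed.

Lemma quot_form (U : {vspace V}) h : (forall v, v \in U -> h v = 0) ->
  exists g : {scalar quotv U}, forall v, g (quot_proj U v) = h v.
Proof.
move=> hU.
have gl : linear_for *%R (fun y : quotv U => h (vsval y)).
  by move=> a u v; rewrite !linearP.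
exists (HB.pack (fun y : quotv U => h (vsval y))
  (GRing.isLinear.Build _ _ _ _ _ gl) : {scalar quotv U}) => v /=.
apply/eqP; rewrite -subr_eq0 -linearB /=; apply/eqP/hU/quot_proj_eq.
by rewrite quot_proj_val.
Qed.

Lemma star_cone0 tau sigma b : tau b -> sigma b -> star_cone tau sigma 0.
Proof. by move=> tb sb; exists 0, b, b; rewrite scale0r. Qed.

Lemma star_cone_proj tau sigma a b : sigma a -> tau b ->
  star_cone tau sigma (quot_proj (dirspace tau) (a - b)).
Proof. by move=> sa tb; exists 1, a, b; rewrite scale1r ler01. Qed.

Lemma dirspace_star_cone tau sigma : tau !=set0 -> tau `<=` sigma ->
  dirspace (star_cone tau sigma) = (quot_hom (dirspace tau) @: dirspace sigma)%VS.
Proof.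
move=> [b tb] ts; apply/eqP; rewrite eqEsubv; apply/andP; split.
  apply: dirspace_min => _ _ [r [a [c [_ sa tc ->]]]] [r' [a' [c' [_ sa' tc' ->]]]].
  rewrite -!linearZ -linearB /=.
  have := memv_img (quot_hom (dirspace tau))
    (_ : r *: (a - c) - r' *: (a' - c') \in dirspace sigma).
  rewrite lfunE; apply; apply: memvB; apply: memvZ; apply: dirspace_mem => //; exact: ts.
apply/subvP => _ /memv_imgP[v vs ->]; rewrite lfunE /=.
suff /subvP/(_ _ vs) : (dirspace sigma <=
    quot_hom (dirspace tau) @^-1: dirspace (star_cone tau sigma))%VS.
  by rewrite -memv_preim lfunE.
apply: dirspace_min => x y sx sy; rewrite -memv_preim lfunE /=.
have -> : x - y = (x - b) - (y - b) by rewrite opprB addrA addrNK.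
by rewrite linearB /=; apply: dirspace_mem; apply: star_cone_proj.
Qed.

Lemma lker_quot_hom (U : {vspace V}) : lker (quot_hom U) = U.
Proof.
apply/vspaceP => v; rewrite memv_ker lfunE /=.
by apply/eqP/idP => /quot_proj_ker.
Qed.

Lemma quot_proj_dirspace_star_cone tau sigma v : tau !=set0 -> tau `<=` sigma ->
  (quot_proj (dirspace tau) v \in dirspace (star_cone tau sigma)) =
  (v \in dirspace sigma).
Proof.
move=> ne ts; rewrite dirspace_star_cone//; apply/idP/idP => [/memv_imgP[x xs]|vs].
  rewrite lfunE /= => /quot_proj_eq /(subvP (dirspaceS ts)) vx.
  by rewrite -(subrK x v) memvD.
by have := memv_img (quot_hom (dirspace tau)) vs; rewrite lfunE.
Qed.

(** The directions of the cone are the image of V_sigma under the projection,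
    whose kernel V_tau is contained in V_sigma. *)
Lemma pdim_star_cone tau sigma : tau !=set0 -> tau `<=` sigma ->
  (pdim tau + pdim (star_cone tau sigma) = pdim sigma)%N.
Proof.
move=> ne ts; rewrite /pdim dirspace_star_cone//.
rewrite -(limg_ker_dim (quot_hom (dirspace tau)) (dirspace sigma)) lker_quot_hom.
by have /capv_idPr -> := dirspaceS ts.
Qed.

(** The linear form cutting out tau in sigma descends to the quotient, where it is
    positive on the cone except at the origin: this makes the origin a face. *)
Lemma min_locus_star_cone tau sigma h
    (g : {scalar quotv (dirspace tau)}) :
  tau !=set0 -> min_locus h sigma = tau ->
  (forall v, g (quot_proj (dirspace tau) v) = h v) ->
  min_locus g (star_cone tau sigma) = [set 0].
Proof.
move=> [b tb] tauE gh; have ts : tau `<=` sigma by rewrite -tauE; apply: min_locus_sub.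
have ge0 y : star_cone tau sigma y -> 0 <= g y.
  move=> [r [a [c [r0 sa tc ->]]]]; rewrite linearZ /= gh linearB /=.
  by rewrite mulr_ge0// subr_ge0; move: tc; rewrite -tauE => -[_]; apply.
have C0 : star_cone tau sigma 0 by apply: star_cone0 tb (ts _ tb).
apply/seteqP; split=> [_ [[r [a [c [r0 sa tc ->]]]] /(_ _ C0)]|_ ->].
  rewrite linear0 linearZ /= gh => le0.
  have [->|rn0] := eqVneq r 0; first by rewrite scale0r.
  have [ta|nta] := pselect (tau a).
    have /quot_proj_ker -> := dirspace_mem ta tc; exact: scaler0.
  have rp : 0 < r by rewrite lt_neqAle eq_sym rn0.
  move: le0; rewrite pmulr_rle0// linearB /= subr_le0 leNgt.
  by rewrite (@min_locus_lt _ _ h sigma)// tauE.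
by split=> // y /ge0; rewrite linear0.
Qed.

(** V_sigma and the form h both descend to the quotient by V_tau, and so does
    the defining property of the primitive normal vector. *)
Lemma normal_rep_star_cone (L : set V) tau sigma u : tau !=set0 ->
  normal_rep L sigma tau u ->
  normal_rep (quot_lattice L tau) (star_cone tau sigma) [set 0]
    (quot_proj (dirspace tau) u).
Proof.
move=> ne [[us Lu] gen [h [hL tauE hu]]].
have ts : tau `<=` sigma by rewrite -tauE; apply: min_locus_sub.
split.
- by split; [rewrite /= quot_proj_dirspace_star_cone|exists u].
- move=> _ [/[swap] -[v Lv <-]]; rewrite /= quot_proj_dirspace_star_cone// => vs.
  have [z [vz Lvz]] := gen v (conj vs Lv); exists z.
  rewrite -raddfMz -linearB /=; split; last by exists (v - u *~ z).
  by have /quot_proj_ker -> := vz; apply: mem0v.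
- have [|g gh] := @quot_form (dirspace tau) h.
    by move=> v; rewrite -tauE; apply: min_locus_dirspace0.
  exists g; split; last by rewrite gh.
    by move=> _ [v Lv <-]; rewrite gh; apply: hL.
  exact: min_locus_star_cone tauE gh.
Qed.

(** Both vectors are positive multiples of any nonzero point y of the ray, the
    positivity being forced by the two linear forms. Each is an integer multiple
    of the other, so the two integers are positive with product one. *)
Lemma normal_rep_line_uniq (L : set V) rho u u' : pdim rho = 1%N ->
  normal_rep L rho [set 0] u -> normal_rep L rho [set 0] u' -> u = u'.
Proof.
move=> dim1 [Lu gen [g [_ gE gu]]] [Lu' gen' [g' [_ g'E gu']]].
have rho0 : rho 0 by apply: (@min_locus_sub _ _ g); rewrite gE.
have [y ry y0] : exists2 y, rho y & y <> 0.
  apply: contrapT => no; have : (dirspace rho <= 0)%VS.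
    rewrite -(dirspace1 0); apply: dirspaceS => y ry.
    by apply: contrapT => y0; apply: no; exists y.
  by move=> /dimvS; rewrite dimv0 -/(pdim rho) dim1.
have lineE : <[y]>%VS = dirspace rho.
  apply/eqP; rewrite eqEdim -/(pdim rho) dim1 dim_vline; apply/andP; split.
    by rewrite -memvE -[y]subr0; apply: dirspace_mem.
  by case: eqP.
have pos (f : {scalar V}) : min_locus f rho = [set 0] -> 0 < f y.
  move=> fE; have := @min_locus_lt _ _ f rho 0 y; rewrite fE linear0; exact.
have coef (f : {scalar V}) x : min_locus f rho = [set 0] -> 0 < f x ->
    cell_lattice L rho x -> exists2 a, 0 < a & x = a *: y.
  move=> fE fx [+ _]; rewrite /= -lineE => /vlineP[a xE]; exists a => //.
  by move: fx; rewrite xE linearZ /= pmulr_lgt0// pos.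
have [a a0 uE] := coef _ _ gE gu Lu.
have [a' a'0 u'E] := coef _ _ g'E gu' Lu'.
have zero x : cell_lattice L [set 0] x -> x = 0.
  by move=> [+ _]; rewrite /= dirspace1 memv0 => /eqP.
have [z /zero/eqP] := gen _ Lu'; have [z' /zero/eqP] := gen' _ Lu.
rewrite !subr_eq0 uE u'E !scalerMzl.
have sI b c : b *: y = c *: y -> b = c.
  move=> /eqP; rewrite -subr_eq0 -scalerBl scaler_eq0 subr_eq0.
  by move=> /orP[/eqP //|/eqP].
move=> /eqP /sI aE /eqP /sI a'E; congr (_ *: _).
have zp : 0 < z by move: a'0; rewrite a'E -mulrzr pmulr_rgt0// ltr0z.
have zp' : 0 < z' by move: a0; rewrite aE -mulrzr pmulr_rgt0// ltr0z.
apply/le_anti/andP; split.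
- by rewrite a'E -mulrzr ler_peMr ?(ltW a0)// ler1z -gtz0_ge1.
- by rewrite aE -mulrzr ler_peMr ?(ltW a'0)// ler1z -gtz0_ge1.
Qed.

(** Take a in sigma outside tau. Since the class of a - b lies in the cone of
    sigma', the direction a - b points into sigma' as well as into sigma from any
    point of tau, up to V_tau; so a small step along it from a relative interior
    point of tau stays in both polyhedra, and leaves tau. *)
Lemma star_cone_inter (L : set V) tau sigma sigma' h :
  rational_polyhedron L tau -> rational_polyhedron L sigma ->
  rational_polyhedron L sigma' -> tau !=set0 -> min_locus h sigma = tau ->
  tau <> sigma -> tau `<=` sigma' -> star_cone tau sigma `<=` star_cone tau sigma' ->
  exists2 x, (sigma `&` sigma') x & ~ tau x.
Proof.
move=> ptau [m [g [c [_ sE]]]] [m' [g' [c' [_ s'E]]]] ne tauE tne ts' sub.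
have ts : tau `<=` sigma by rewrite -tauE; apply: min_locus_sub.
have [a sa nta] : exists2 a, sigma a & ~ tau a.
  by move: tne; rewrite -tauE => /proper_min_locus.
have [b tb] := ne.
have [r [a' [b' [r0 s'a' tb' E]]]] := sub _ (star_cone_proj sa tb).
move: E; rewrite -linearZ /= => /quot_proj_eq vt.
set v := a - b in vt *.
(* The inequalities of both polyhedra are treated as one system, so that a
   single point of tau and a single step length serve for both. *)
pose G (i : 'I_m + 'I_m') := match i with inl i => g i | inr i => g' i end.
pose C (i : 'I_m + 'I_m') := match i with inl i => c i | inr i => c' i end.
have [||||p [e [tp e0 He]]] := @small_step _ _ _ G C tau v.
- exact: ne.
- exact: polyhedron_midpoint ptau.
- by case=> i x; [move=> /ts; rewrite sE|move=> /ts'; rewrite s'E]; apply.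
- case=> i /= tight.
    by rewrite linearB /= (tight b)// subr_ge0; move: sa; rewrite sE; apply.
  have : g' i (v - r *: (a' - b')) = 0.
    apply: linear_const_dirspace vt => x y tx ty.
    by rewrite (tight x)// (tight y).
  rewrite linearB linearZ /= => /eqP; rewrite subr_eq0 => /eqP ->.
  rewrite mulr_ge0// linearB /= (tight b')// subr_ge0.
  by move: s'a'; rewrite s'E; apply.
exists (p + e *: v).
  by split; rewrite ?sE ?s'E => i; [apply: (He (inl i))|apply: (He (inr i))].
have hv : 0 < h v.
  by rewrite linearB /= subr_gt0; apply: (@min_locus_lt _ _ h sigma) => //; rewrite tauE.
rewrite -tauE => tx; have : h p = h (p + e *: v).
  by apply: min_locus_const tx; rewrite tauE.
by rewrite linearD linearZ /=; have := mulr_gt0 e0 hv; lra.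
Qed.
End Star.

(** * The balancing condition of the star *)

Section Complex.
Variables (R : realType) (V : vectType R) (L : set V) (d : nat) (X : set (set V)).
Implicit Types (sigma tau : set V).

(** A cell that is not maximal is a proper face of a cell of larger dimension, to
    which the argument applies again; dimensions being bounded, this ends at a
    maximal cell, of dimension d. *)
Lemma maximal_or_pdim_lt sigma : pure_dim d X -> X sigma ->
  maximal_cells X sigma \/ (pdim sigma < d)%N.
Proof.
move=> pure; have [n] := ubnP (\dim {: V} - pdim sigma).
elim: n sigma => // n IHn sigma le_n Xs.
have [max|nmax] := pselect (maximal_cells X sigma); [by left|right].
have [sigma' Xs' pf] : exists2 sigma', X sigma' & proper_face sigma sigma'.
  by apply: contrapT => no; apply: nmax; split=> // s' Xs' pf; apply: no; exists s'.
have lt := pdim_proper_face pf.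
apply: (leq_trans lt); have [|/pure ->//|/ltnW//] := IHn sigma' _ Xs'.
rewrite -ltnS; apply: leq_ltn_trans le_n; apply: ltn_sub2l => //.
by apply: leq_trans lt _; apply: dimvS; rewrite subvf.
Qed.

Hypothesis cX : polyhedral_complex L X.
Hypothesis pX : pure_dim d X.
Variables (tau : set V).
Hypotheses (Xtau : X tau) (codim : (pdim tau).+1 = d).

Lemma maximal_of_proper_face sigma : X sigma -> proper_face tau sigma ->
  maximal_cells X sigma.
Proof.
move=> Xs /pdim_proper_face; rewrite -ltnS codim ltnS => ge.
by case: (maximal_or_pdim_lt pX Xs) => //; rewrite ltnNge ge.
Qed.

(** If sigma were not contained in sigma', their intersection would be a proper
    face of sigma, hence of dimension less than d; but by [star_cone_inter] it
    is strictly larger than tau, and so has dimension at least d. *)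
Lemma star_cone_sub sigma sigma' : X sigma -> X sigma' ->
  proper_face tau sigma -> proper_face tau sigma' ->
  star_cone tau sigma `<=` star_cone tau sigma' -> sigma `<=` sigma'.
Proof.
move=> Xs Xs' pf pf' sub.
have [_ poly _ inter] := cX.
have [[ne [h tauE]] tne] := pf; have [[_ [h' tauE']] _] := pf'.
have ts : tau `<=` sigma by rewrite tauE; apply: min_locus_sub.
have ts' : tau `<=` sigma' by rewrite tauE'; apply: min_locus_sub.
have [x [sx s'x] ntx] := star_cone_inter (poly _ Xtau).1 (poly _ Xs).1
  (poly _ Xs').1 ne (esym tauE) tne ts' sub.
have [/setIidPl//|ne'] := pselect (sigma `&` sigma' = sigma).
have [b tb] := ne.
have [fs _] : face (sigma `&` sigma') sigma /\ face (sigma `&` sigma') sigma'.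
  by apply: inter => //; exists x.
have := pdim_proper_face (conj fs ne').
rewrite (pX (maximal_of_proper_face Xs pf)) -codim ltnS leqNgt.
case/negP; apply: (@ltn_pdim _ _ h _ _ b x) => //.
- by move=> y ty; split; [apply: ts|apply: ts'].
- by move=> v; rewrite tauE; apply: min_locus_dirspace0.
- by split; [apply: ts|apply: ts'].
- by apply: (@min_locus_lt _ _ h sigma); rewrite -?tauE.
Qed.

(** The origin is the only zero-dimensional cell of the star, and it is a facet
    of exactly the rays spanned by the u_j. *)
Lemma star_balancedE k (t : 'I_k -> set V) (u : 'I_k -> V) (w : set V -> int) :
  set_bij [set: 'I_k]
    [set sigma | maximal_cells X sigma /\ proper_face tau sigma] t ->
  (forall j, normal_rep L (t j) tau (u j)) ->
  star_balanced L d X tau w <-> \sum_(j < k) u j *~ w (t j) \in dirspace tau.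
Proof.
move=> [tfun tinj tsurj] hu.
have [maxt pft] : (forall j, maximal_cells X (t j)) /\
    (forall j, proper_face tau (t j)).
  by split=> j; have [] := tfun j I.
have Xt j : X (t j) by have [] := maxt j.
have sub sigma : proper_face tau sigma -> tau `<=` sigma.
  by move=> [[_ [h ->]] _]; apply: min_locus_sub.
have ne : tau !=set0 by have [_ /(_ _ Xtau)[]] := cX.
have dE : (d - pdim tau = 1)%N by rewrite -codim subSnn.
have pdimC j : pdim (star_cone tau (t j)) = 1%N.
  apply/eqP; rewrite -(eqn_add2l (pdim tau)) pdim_star_cone//; last exact: sub.
  by rewrite (pX (maxt j)) -codim addn1.
have pdim0 : pdim ([set 0] : set (quotv (dirspace tau))) = 0%N.
  by rewrite /pdim dirspace1 dimv0.
have conesP rho : star X tau rho ->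
    rho = [set 0] \/ exists j, rho = star_cone tau (t j).
  move=> [[sigma [Xs pf] <-]|->]; [right|by left].
  by have [j _ <-] := tsurj sigma (conj (maximal_of_proper_face Xs pf) pf); exists j.
have repC j := normal_rep_star_cone ne (hu j).
have coneI i j : star_cone tau (t i) = star_cone tau (t j) -> t i = t j.
  by move=> e; apply/seteqP; split; apply: star_cone_sub => //; rewrite e.
have bijC : set_bij [set: 'I_k]
    [set rho | [/\ star X tau rho, pdim rho = (d - pdim tau)%N &
                   proper_face [set 0] rho]] (fun j => star_cone tau (t j)).
  split.
  - move=> j _ /=; split; [by left; exists (t j)|by rewrite dE|split].
      have [_ _ [g [_ gE _]]] := repC j.
      by split; [exists 0|exists g].
    by move=> e; have := pdimC j; rewrite -e pdim0.
  - by move=> i j _ _ /coneI; apply: tinj; rewrite inE.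
  - move=> rho [/conesP[->|[j ->] _ _]]; last by exists j.
    by rewrite pdim0 dE.
have weightC j : star_weight X w (star_cone tau (t j)) = w (t j).
  rewrite /star_weight; case: xgetP => [sigma _ [ms pf e]|/(_ (t j))[]//].
  have [i _ ti] := tsurj sigma (conj ms pf).
  by congr w; rewrite -ti; apply: coneI; rewrite ti.
have normC j : normal_vector (quot_lattice L tau) (star_cone tau (t j)) [set 0] =
    quot_proj (dirspace [set 0]) (quot_proj (dirspace tau) (u j)).
  rewrite /normal_vector; congr quot_proj; apply/esym.
  case: xgetP => [v _ /(normal_rep_line_uniq (pdimC j) (repC j))//|no].
  by case: (no _ (repC j)).
have sumE : \sum_(rho \in [set rho | [/\ star X tau rho,
      pdim rho = (d - pdim tau)%N & proper_face [set 0] rho]])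
      normal_vector (quot_lattice L tau) rho [set 0] *~ star_weight X w rho =
    quot_proj (dirspace [set 0])
      (quot_proj (dirspace tau) (\sum_(j < k) u j *~ w (t j))).
  rewrite (reindex_fsbig _ _ _ _ bijC).
  have -> : [set: 'I_k] = [set` enum 'I_k].
    by apply/seteqP; split=> j //= _; rewrite mem_enum.
  rewrite -fsbig_seq ?enum_uniq// big_enum !linear_sum /=.
  by apply: eq_bigr => j _; rewrite weightC normC !raddfMz.
(* [normal_vector] projects once more, modulo the zero space of directions of
   the origin; this second projection is injective. *)
rewrite -quot_proj_ker; split=> [/(_ [set 0])|sum0 rho /conesP[->|[j ->]]].
- rewrite sumE pdim0 dE => /(_ (or_intror erefl) erefl)/quot_proj_ker.
  by rewrite dirspace1 memv0 => /eqP.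
- by rewrite sumE sum0 linear0.
- by rewrite pdimC dE.
Qed.
End Complex.

(** * Integer vectors and the isomorphism *)

(** Membership in A depends only on the coordinates selected by f, so A is the
    product of K with the free group on the coordinates outside the image
    of f. *)
Lemma isomorphic_coordinates (k N : nat) (f : 'I_k -> 'I_N) (A : set 'cV[int]_N)
    (K : set 'cV[int]_k) : injective f -> subgroup K ->
  (forall x, A x <-> K (\col_j x (f j) 0)) ->
  isomorphic A (K `*` [set: 'cV[int]_(N - k)]).
Proof.
move=> finj [K0 KB] AE.
pose C := ~: (f @: [set: 'I_k])%SET.
have cardC : #|C| = (N - k)%N by rewrite cardsCs finset.setCK card_imset// cardsT !card_ord.
(* e enumerates the indices that f misses. *)
pose e (j : 'I_(N - k)) := enum_val (cast_ord (esym cardC) j).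
have einj : injective e by move=> i j /enum_val_inj/cast_ord_inj.
have fe i j : f i != e j.
  apply/eqP => fie; have := enum_valP (cast_ord (esym cardC) j).
  by rewrite -/(e j) -fie inE imset_f.
have cover i : (exists j, i = f j) \/ (exists j, i = e j).
  have [/imsetP[j _ ->]|iC] := boolP (i \in (f @: [set: 'I_k])%SET).
    by left; exists j.
  right; have iC' : i \in C by rewrite inE.
  by exists (cast_ord cardC (enum_rank_in iC' i)); rewrite /e cast_ordK enum_rankK_in.
split.
- split=> [|x y /AE Kx /AE Ky]; apply/AE.
    by have -> : \col_j (0 : 'cV[int]_N) (f j) 0 = 0 by apply/colP => j; rewrite !mxE.
  have -> : \col_j (x - y) (f j) 0 = \col_j x (f j) 0 - \col_j y (f j) 0.
    by apply/colP => j; rewrite !mxE.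
  exact: KB.
- by split=> // x y [Kx _] [Ky _]; split=> //; apply: KB.
exists (fun x : 'cV[int]_N => (\col_j x (f j) 0, \col_j x (e j) 0)); split=> [x y _ _|].
  by congr (_, _); apply/colP => j; rewrite !mxE.
split.
- by move=> x /AE.
- move=> x y _ _ [/colP fxy /colP exy]; apply/colP => i.
  by have [[j ->]|[j ->]] := cover i; [have := fxy j|have := exy j]; rewrite !mxE.
- move=> [y z] [/= Ky _].
  pose x : 'cV[int]_N :=
    \col_i (\sum_(j | f j == i) y j 0 + \sum_(j | e j == i) z j 0).
  have xf : \col_j x (f j) 0 = y.
    apply/colP => j; rewrite !mxE (big_pred1 j) => [|i]; last exact: inj_eq.
    by rewrite big_pred0 ?addr0// => i; rewrite eq_sym (negPf (fe _ _)).
  have xe : \col_j x (e j) 0 = z.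
    apply/colP => j; rewrite !mxE [X in _ + X](big_pred1 j) => [|i]; last exact: inj_eq.
    by rewrite big_pred0 ?add0r// => i; rewrite (negPf (fe _ _)).
  by exists x; [apply/AE; rewrite xf|rewrite xf xe].
Qed.

Lemma weight_ofE (T : choiceType) (N : nat) (s : 'I_N -> T) (omega : 'cV[int]_N) i :
  injective s -> weight_of s omega (s i) = omega i 0.
Proof. by move=> sI; rewrite /weight_of (big_pred1 i)// => j; apply: inj_eq. Qed.

Lemma intvec_inj (R : realType) n : injective (@intvec R n).
Proof.
move=> x y /colP xy; apply/colP => i; have := xy i; rewrite !mxE.
exact: (mulrIz (oner_neq0 _)).
Qed.

Lemma intvec_mulmx (R : realType) n k (U : 'M[int]_(n, k)) (x : 'cV[int]_k) :
  intvec R (U *m x) = \sum_j intvec R (col j U) *~ x j 0.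
Proof.
apply/colP => i; rewrite summxE !mxE rmorph_sum; apply: eq_bigr => j _.
by rewrite -scaler_int !mxE rmorphM mulrC.
Qed.

(** U x = B c means that (x, -c) is in the kernel of the block matrix. *)
Lemma mulmx_in_latticeP (R : realType) (n m k : nat) (W : set 'cV[R]_n)
    (U : 'M[int]_(n, k)) (B : 'M[int]_(n, m)) (x : 'cV[int]_k) :
  lattice_basis (W `&` Zlattice R n) B ->
  W (intvec R (U *m x)) <-> (usubmx @` int_ker (row_mx U B)) x.
Proof.
move=> [Bfun _ Bsurj]; split=> [Wx|[y + <-]].
  have [c _ /intvec_inj cE] := Bsurj (intvec R (U *m x)) (conj Wx (imageT _ _)).
  exists (col_mx x (- c)); last by rewrite col_mxKu.
  by rewrite /int_ker /= mul_row_col mulmxN cE subrr.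
rewrite /int_ker /= -{1}[y]vsubmxK mul_row_col => /eqP; rewrite addr_eq0 => /eqP ->.
by rewrite -mulmxN; have [] := Bfun (- dsubmx y) I.
Qed.

Lemma subgroup_usubmx_ker n m k (M : 'M[int]_(n, k + m)) :
  subgroup (usubmx @` int_ker M).
Proof.
split=> [|_ _ [x Mx <-] [y My <-]].
  by exists 0; [rewrite /int_ker /= mulmx0|rewrite linear0].
by exists (x - y); rewrite ?linearB// /int_ker /= mulmxBr Mx My subrr.
Qed.

Theorem proposition3p17 (R : realType) (n d : nat)
  (X : set (set 'cV[R]_n)) (w : set 'cV[R]_n -> int)
  (hX : tropical_cycle (Zlattice R n) d X w)
  (N : nat) (s : 'I_N -> set 'cV[R]_n)
  (hs : set_bij [set: 'I_N] (maximal_cells X) s)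
  (tau : set 'cV[R]_n) (htau : X tau) (hcodim : (pdim tau).+1 = d)
  (k : nat) (t : 'I_k -> set 'cV[R]_n)
  (ht : set_bij [set: 'I_k]
          [set sigma | maximal_cells X sigma /\ proper_face tau sigma] t)
  (U : 'M[int]_(n, k))
  (hU : forall j, normal_rep (Zlattice R n) (t j) tau (intvec R (col j U)))
  (B : 'M[int]_(n, d.-1))
  (hB : lattice_basis (cell_lattice (Zlattice R n) tau) B) :
  isomorphic (weight_lattice (Zlattice R n) d X s tau)
    ((usubmx @` int_ker (row_mx U B)) `*` [set: 'cV[int]_(N - k)]).
Proof.
have [cX pX _] := hX.
have [_ sinj ssurj] := hs; have [tfun tinj _] := ht.
have sI : injective s by move=> i j; apply: sinj; rewrite inE.
have tI : injective t by move=> i j; apply: tinj; rewrite inE.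
have /choice[f fE] : forall j, exists i, s i = t j.
  by move=> j; have [mt _] := tfun j I; have [i _ <-] := ssurj _ mt; exists i.
apply: (@isomorphic_coordinates _ _ f) => [i j fij||omega].
- by apply: tI; rewrite -!fE fij.
- exact: subgroup_usubmx_ker.
apply: iff_trans (star_balancedE cX pX htau hcodim _ ht hU) _.
apply: iff_trans (mulmx_in_latticeP U _ hB); rewrite /= intvec_mulmx.
under eq_bigr => j _ do rewrite -fE weight_ofE//.
by under [in X in _ <-> X]eq_bigr => j _ do rewrite mxE.
Qed.
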